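(* Let $w:\mathbb{C}\to\mathbb{R}$ be subharmonic and $u:\mathbb{C}\to\mathbb{R}$ harmonic. Suppose there exists a function $\Phi:\mathbb{R}\to[0,+\infty)$ which is locally bounded, satisfies $\lim_{|t|\to\infty}\Phi(t)/|t|=0$, and such that $w(z)\le\Phi(u(z))$ for all $z\in\mathbb{C}$. Then $w$ is constant. *)

(* Defs.v *)
(* The complex plane C is identified with R x R,
   a function C -> R being written as f : R -> R -> R, f x y = f(x + i y). *)
From HB Require Import structures.
From mathcomp Require Import all_boot all_order all_algebra.
From mathcomp Require Import all_classical all_reals all_analysis.
Set Implicit Arguments. Unset Strict Implicit. Unset Printing Implicit Defensive.
Import Order.TTheory GRing.Theory Num.Theory.
Import numFieldNormedType.Exports.
Local Open Scope classical_set_scope.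
Local Open Scope ring_scope.

Section Defs.
Variable R : realType.

Definition dx (f : R -> R -> R) : R -> R -> R := fun x y => derive1 (fun t => f t y) x.
Definition dy (f : R -> R -> R) : R -> R -> R := fun x y => derive1 (fun t => f x t) y.

Definition derivable2 (f : R -> R -> R) : Prop :=
  forall x y, derivable (fun t => f t y) x 1 /\ derivable (fun t => f x t) y 1.

Definition jcont (f : R -> R -> R) : Prop :=
  continuous (fun p : R * R => f p.1 p.2).

Definition C2 (f : R -> R -> R) : Prop :=
  derivable2 f /\ derivable2 (dx f) /\ derivable2 (dy f) /\
  jcont f /\ jcont (dx f) /\ jcont (dy f) /\
  jcont (dx (dx f)) /\ jcont (dy (dx f)) /\ jcont (dx (dy f)) /\
  jcont (dy (dy f)).

Definition harmonic_fun (u : R -> R -> R) : Prop :=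
  C2 u /\ forall x y, dx (dx u) x y + dy (dy u) x y = 0.

Definition usc (w : R -> R -> R) : Prop :=
  forall p : R * R, forall e : R, 0 < e ->
    \forall q \near p, w q.1 q.2 < w p.1 p.2 + e.

Definition subharmonic_fun (w : R -> R -> R) : Prop :=
  usc w /\
  forall x y r : R, 0 < r ->
    ((w x y)%:E <= ((2 * pi)^-1)%:E *
      \int[lebesgue_measure]_(t in `[0%R, (2 * pi)%R]%classic)
         (w (x + r * cos t) (y + r * sin t))%:E)%E.

Definition locally_bounded (Phi : R -> R) : Prop :=
  forall t : R, exists M : R, \forall s \near t, `|Phi s| <= M.

End Defs.

(* Main.v *)
(* On the open set {u > 0} the function w - eps u is subharmonic and bounded
   above, and on its boundary w <= Phi 0.  If u is negative somewhere, then
   {u >= 0} misses a disc D(a, d), so ln(|z - a|/d) is a positive harmonic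
   function tending to infinity there, and the Phragmen-Lindelof principle gives
   w - eps u <= Phi 0; letting eps -> 0, w <= Phi 0 on {u > 0}, and likewise on
   {u < 0}.  Hence w is bounded above and constant by Liouville's theorem.
   If u does not change sign, Liouville's theorem applies directly to
   w - eps |u|, and again eps -> 0.  Liouville's theorem itself is the
   Phragmen-Lindelof principle on the complement of a small disc.

   The maximum principle behind this is obtained without connectedness: adding
   kappa |z - a|^2 makes the Laplacian of the comparison function positive, and
   then a second-order expansion integrated over a small circle contradicts the
   sub-mean value inequality at an interior maximum. *)
Require Import Defs.
From HB Require Import structures.
From mathcomp Require Import all_boot all_order all_algebra.
From mathcomp Require Import all_classical all_reals all_analysis.
From mathcomp Require Import ring lra.
Import Order.TTheory GRing.Theory Num.Theory.
Import numFieldNormedType.Exports.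
Local Open Scope classical_set_scope.
Local Open Scope ring_scope.

(* No measurability is needed: the integral of a nonnegative function is a
   supremum over simple functions below it. *)
Lemma le_integral_pointwise d (T : measurableType d) (R : realType)
    (mu : {measure set T -> \bar R}) (D : set T) (f g : T -> \bar R) :
  (forall x, D x -> (f x <= g x)%E) ->
  (\int[mu]_(x in D) f x <= \int[mu]_(x in D) g x)%E.
Proof.
move=> fg.
have fg' x : ((f \_ D) x <= (g \_ D) x)%E.
  by rewrite /patch; case: ifPn => // /set_mem; exact: fg.
rewrite /integral; apply: leeB; apply: ereal_sup_le => _ [h /= hf <-];
  exists h => // x; apply: (le_trans (hf x)).
- by apply: (@funepos_le _ _ setT) => //; rewrite inE.
- by apply: (@funeneg_le _ _ setT) => //; rewrite inE.
Qed.

(** * Circle integrals of quadratic polynomials, and second-order lower expansions *)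

Section Jets.
Variable R : realType.
Implicit Types (f g u w : R -> R -> R).

Definition quad (A B C D E h k : R) : R :=
  A * h + B * k + C * h ^+ 2 + D * (h * k) + E * k ^+ 2.

(** Over a full turn the linear and mixed terms cancel and each square contributes [pi * r ^+ 2], so
    only the trace [C + E] survives. [F] is an explicit primitive of the integrand. *)
Lemma integral_circle_quad (A B C D E c r : R) :
  (\int[lebesgue_measure]_(t in `[0%R, (2 * pi)%R]%classic)
     (c + quad A B C D E (r * cos t) (r * sin t))%:E =
   (2 * pi * c + pi * r ^+ 2 * (C + E))%:E)%E.
Proof.
pose F t : R := c * t + A * r * sin t - B * r * cos t +
  r ^+ 2 / 2 * (C * (t + cos t * sin t) + D * sin t ^+ 2
                + E * (t - cos t * sin t)).
have dF (t : R) :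
    is_derive t (1:R) F (c + quad A B C D E (r * cos t) (r * sin t)).
  rewrite /F /quad; apply: is_derive_eq.
  rewrite /GRing.scale /=.
  move: (cos t) (sin t) (cos2Dsin2 t) => x y xy.
  (* Homogenising the constant [1] leaves a polynomial identity. *)
  rewrite -[in 1 + _]xy -[in 1 - _]xy.
  by field.
have cF (t : R) : {for t, continuous F}.
  apply: differentiable_continuous.
  by apply/derivable1_diffP; apply: ex_derive.
rewrite (@continuous_FTC2 R _ F).
- rewrite -EFinB; congr (_%:E); rewrite /F.
  rewrite mulr_natl cos2pi sin2pi cos0 sin0 -mulr_natl; by field.
- by rewrite mulr_gt0// pi_gt0.
- apply: continuous_subspaceT => t.
  apply: differentiable_continuous; apply/derivable1_diffP.
  by rewrite /quad; apply: ex_derive.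
- split => //.
  + by apply: cvg_at_right_filter; exact: cF.
  + by apply: cvg_at_left_filter; exact: cF.
- by move=> t _; rewrite derive1E; exact: derive_val.
Qed.

(* For g of class C2 this holds with L half of the Laplacian; the one-sided form
   is all that the comparison at a maximum uses. *)
Definition lower_jet g (x y L : R) :=
  exists A B C D E : R, C + E = L /\ forall e : R, 0 < e -> exists2 d : R, 0 < d &
    forall h k, `|h| < d -> `|k| < d ->
      g x y + quad A B C D E h k - e * (h ^+ 2 + k ^+ 2) <= g (x + h) (y + k).

Lemma lower_jetD f g x y L M : lower_jet f x y L -> lower_jet g x y M ->
  lower_jet (fun a b => f a b + g a b) x y (L + M).
Proof.
move=> [A [B [C [D [E [CE Hf]]]]]] [A' [B' [C' [D' [E' [CE' Hg]]]]]].
exists (A + A'), (B + B'), (C + C'), (D + D'), (E + E'); split.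
  by rewrite -CE -CE'; ring.
move=> e e0.
have [d d0 hd] := Hf (e / 2) (divr_gt0 e0 (ltr0n _ 2)).
have [d' d'0 hd'] := Hg (e / 2) (divr_gt0 e0 (ltr0n _ 2)).
exists (Num.min d d'); first by rewrite lt_min d0.
move=> h k; rewrite !lt_min => /andP[h1 h2] /andP[k1 k2].
have := lerD (hd _ _ h1 k1) (hd' _ _ h2 k2); apply: le_trans.
rewrite /quad le_eqVlt; apply/orP; left; apply/eqP; by field.
Qed.

Lemma lower_jetZ c g x y L : 0 < c -> lower_jet g x y L ->
  lower_jet (fun a b => c * g a b) x y (c * L).
Proof.
move=> c0 [A [B [C [D [E [CE Hf]]]]]].
exists (c * A), (c * B), (c * C), (c * D), (c * E); split.
  by rewrite -CE; ring.
move=> e e0.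
have [d d0 hd] := Hf (e / c) (divr_gt0 e0 c0).
exists d => // h k hd1 kd1.
have := hd h k hd1 kd1; rewrite -(ler_pM2l c0); apply: le_trans.
rewrite /quad le_eqVlt; apply/orP; left; apply/eqP; field.
by rewrite gt_eqF.
Qed.

(** The perturbation whose positive [L] makes the maximum principle strict; its expansion is
    exact. *)
Lemma lower_jet_sqdist a b x y :
  lower_jet (fun x y => (x - a) ^+ 2 + (y - b) ^+ 2) x y 2.
Proof.
exists (2 * (x - a)), (2 * (y - b)), 1, 0, 1; split; first by ring.
move=> e e0; exists 1 => // h k _ _; rewrite /quad.
have : 0 <= e * (h ^+ 2 + k ^+ 2).
  by rewrite mulr_ge0 ?(ltW e0)// addr_ge0 ?sqr_ge0.
rewrite -subr_ge0 => H; rewrite -subr_ge0.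
apply: (le_trans H); rewrite le_eqVlt; apply/orP; left; apply/eqP; ring.
Qed.

(** At such a maximum, [w] on a small circle is at most [w x y] minus the quadratic part of [g], up
    to a small error. Averaging gives a mean strictly below [w x y], against the sub-mean value
    inequality. *)
Lemma subharmonic_add_jet_no_max w g x y L : subharmonic_fun w ->
  lower_jet g x y L -> 0 < L ->
  ~ \forall q \near (x, y), w q.1 q.2 + g q.1 q.2 <= w x y + g x y.
Proof.
move=> [_ subm] [A [B [C [D [E [CE Hf]]]]]] L0 /nbhs_ballP[d1 /= d10 hd1].
(* The quadratic part has circle mean [L / 2 * r ^+ 2]; an error of half that size leaves a net drop
   of [L / 4 * r ^+ 2]. *)
have [d d0 hd] := Hf (L / 4) (divr_gt0 L0 (ltr0n _ 4)).
set r : R := Num.min d d1 / 2.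
have m0 : 0 < Num.min d d1 by rewrite lt_min d0.
have r0 : 0 < r by rewrite divr_gt0.
have rm : r < Num.min d d1 by rewrite /r ltr_pdivrMr// ltr_pMr// ltr1n.
have := subm x y r r0.
suff H : (\int[lebesgue_measure]_(t in `[0%R, (2 * pi)%R]%classic)
     (w (x + r * cos t) (y + r * sin t))%:E <=
   (2 * pi * (w x y + L / 4 * r ^+ 2) + pi * r ^+ 2 * (- C + - E))%:E)%E.
  move=> /le_trans /(_ (lee_wpmul2l _ H)).
  rewrite lee_fin invr_ge0 mulr_ge0 ?pi_ge0// => /(_ isT).
  rewrite -EFinM lee_fin leNgt => /negP; apply.
  have -> : - C + - E = - L by rewrite -CE opprD.
  have -> : (2 * pi)^-1 * (2 * pi * (w x y + L / 4 * r ^+ 2) +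
      pi * r ^+ 2 * - L) = w x y - L / 4 * r ^+ 2.
    by move: (pi : R) (@pi_gt0 R) => p p0; field; rewrite gt_eqF.
  by rewrite ltrBlDr ltrDl mulr_gt0 ?divr_gt0// exprn_gt0.
rewrite -(integral_circle_quad (- A) (- B) (- C) (- D) (- E)).
apply: le_integral_pointwise => t _; rewrite lee_fin.
have bnd z : `|z| <= 1 -> `|r * z| < Num.min d d1.
  move=> z1; apply: le_lt_trans rm; rewrite normrM gtr0_norm//.
  by rewrite ler_piMr// ltW.
have := bnd _ (cos_max t); have := bnd _ (sin_max t).
rewrite !lt_min => /andP[s1 s2] /andP[c1 c2].
have := hd _ _ c1 s1.
have /hd1 /= : ball (x, y) d1 (x + r * cos t, y + r * sin t).
  by split; rewrite /ball/= opprD addrA subrr add0r normrN.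
have := cos2Dsin2 t.
rewrite /quad; move: (cos t) (sin t) => a b ab H1 H2.
have -> : L / 4 * r ^+ 2 = L / 4 * ((r * a) ^+ 2 + (r * b) ^+ 2).
  by rewrite !exprMn -mulrDr ab mulr1.
lra.
Qed.

End Jets.
Arguments quad {R}.
Arguments lower_jet {R}.

(** * Taylor expansions, and the jets of [C2] functions and of the logarithm *)

Section Taylor.
Variable R : realType.
Implicit Types (f : R -> R) (u : R -> R -> R).

(** Covers both signs of [h] and asks for differentiability only near [x], so that it also applies
    to [ln]. *)
Lemma MVT_near f (f' : R -> R) (x d h : R) :
  (forall s, `|s - x| < d -> is_derive s (1 : R) f (f' s)) -> `|h| < d ->
  exists2 s, `|s - x| <= `|h| & f (x + h) - f x = f' s * h.
Proof.
move=> df hd.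
have cf s : `|s - x| < d -> {for s, continuous f}.
  move=> /df dfs; apply: differentiable_continuous.
  by apply/derivable1_diffP; apply: ex_derive.
have [h0|h0] := leP 0 h.
- have bd s : s \in `[x, x + h] -> `|s - x| <= `|h|.
    by rewrite in_itv /= => /andP[? ?]; rewrite !ger0_norm//; lra.
  have [|s sx||s /bd sx e] := @MVT_segment R f f' x (x + h); first by lra.
  + by apply/df/(le_lt_trans _ hd)/bd; exact: subset_itv_oo_cc.
  + apply: continuous_in_subspaceT => s; rewrite inE /= => /bd sx.
    exact/cf/(le_lt_trans sx).
  + by exists s => //; rewrite e; congr (_ * _); ring.
- have bd s : s \in `[x + h, x] -> `|s - x| <= `|h|.
    by rewrite in_itv /= => /andP[? ?]; rewrite ler0_norm ?ltr0_norm//; lra.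
  have [|s sx||s /bd sx e] := @MVT_segment R f f' (x + h) x; first by lra.
  + by apply/df/(le_lt_trans _ hd)/bd; exact: subset_itv_oo_cc.
  + apply: continuous_in_subspaceT => s; rewrite inE /= => /bd sx.
    exact/cf/(le_lt_trans sx).
  + by exists s => //; rewrite -opprB e; ring.
Qed.

Lemma taylor1_near f (f' : R -> R) (x c e d h : R) :
  (forall s, `|s - x| < d -> is_derive s (1 : R) f (f' s)) ->
  (forall s, `|s - x| < d -> `|f' s - c| <= e) -> `|h| < d ->
  `|f (x + h) - f x - c * h| <= e * `|h|.
Proof.
move=> df f'c hd; have [s sh ->] := MVT_near f f' x d h df hd.
rewrite -mulrBl normrM ler_wpM2r// f'c//; exact: le_lt_trans hd.
Qed.

(** The first-order estimate for [f'] bounds the derivative of the remainder [F] by [e * |s - x|];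
    the mean value theorem then yields [e * h ^+ 2]. *)
Lemma taylor2_near f (f' f'' : R -> R) (x c e d h : R) :
  (forall s, `|s - x| < d -> is_derive s (1 : R) f (f' s)) ->
  (forall s, `|s - x| < d -> is_derive s (1 : R) f' (f'' s)) ->
  (forall s, `|s - x| < d -> `|f'' s - c| <= e) -> `|h| < d ->
  `|f (x + h) - f x - f' x * h - c / 2 * h ^+ 2| <= e * h ^+ 2.
Proof.
move=> df df' f''c hd.
pose F s := f s - f' x * s - c / 2 * (s - x) ^+ 2.
have dF s : `|s - x| < d -> is_derive s (1 : R) F (f' s - f' x - c * (s - x)).
  move=> /df dfs; rewrite /F; apply: is_derive_eq.
  by rewrite /GRing.scale /=; field.
have [s sh] := MVT_near F _ x d h dF hd.
have -> : F (x + h) - F x = f (x + h) - f x - f' x * h - c / 2 * h ^+ 2.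
  by rewrite /F; field.
move=> ->; rewrite normrM -[h ^+ 2]real_normK ?num_real// expr2 mulrA ler_wpM2r//.
have := taylor1_near f' f'' x c e d (s - x) df' f''c (le_lt_trans sh hd).
rewrite subrKC => /le_trans; apply; apply: ler_wpM2l => //.
(* [e] is nonnegative because it bounds an absolute value at [x]. *)
by apply: le_trans (f''c x _); rewrite ?normr_ge0// subrr normr0 (le_lt_trans _ hd).
Qed.

Lemma jcont_near u (x y e : R) : jcont u -> 0 < e -> exists2 d : R, 0 < d &
  forall s t, `|s - x| < d -> `|t - y| < d -> `|u s t - u x y| <= e.
Proof.
move=> cu e0; have /cvgrPdist_le/(_ _ e0)/nbhs_ballP[d /= d0 hd] := cu (x, y).
exists d => // s t sx ty; rewrite distrC; apply: (hd (s, t)).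
by split; rewrite /ball /= distrC.
Qed.

(** The increment is split along [(x, y)], [(x, y + k)], [(x + h, y + k)]. [T2] expands the vertical
    leg, [T1] the horizontal one, and [T3] moves the slope [dx u x (y + k)] back to height [y]; each
    costs [e / 3]. *)
Lemma C2_taylor u (x y e : R) : C2 u -> 0 < e ->
  exists2 d : R, 0 < d & forall h k, `|h| < d -> `|k| < d ->
  `|u (x + h) (y + k) - u x y - quad (dx u x y) (dy u x y)
      (dx (dx u) x y / 2) (dy (dx u) x y) (dy (dy u) x y / 2) h k|
  <= e * (h ^+ 2 + k ^+ 2).
Proof.
move=> [du [dux [duy [_ [_ [_ [cxx [cyx [_ cyy]]]]]]]]] e0.
have e3 : 0 < e / 3 by rewrite divr_gt0.
have [d1 d10 h1] := jcont_near _ x y _ cxx e3.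
have [d2 d20 h2] := jcont_near _ x y _ cyx e3.
have [d3 d30 h3] := jcont_near _ x y _ cyy e3.
exists (Num.min d1 (Num.min d2 d3)); first by rewrite !lt_min d10 d20.
move=> h k; rewrite !lt_min => /and3P[hd1 hd2 hd3] /and3P[kd1 kd2 kd3].
have dxP v a b : derivable2 v ->
    is_derive a (1 : R) (fun s => v s b) (dx v a b).
  by move=> /(_ a b)[+ _]; rewrite /dx derive1E; exact: derivableP.
have dyP v a b : derivable2 v ->
    is_derive b (1 : R) (fun s => v a s) (dy v a b).
  by move=> /(_ a b)[_ +]; rewrite /dy derive1E; exact: derivableP.
have ky : `|y + k - y| < d1 by rewrite addrAC subrr add0r.
have T1 := taylor2_near (fun s => u s (y + k)) _ _ x _ _ _ _
  (fun s _ => dxP _ _ _ du) (fun s _ => dxP _ _ _ dux)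
  (fun s sx => h1 s (y + k) sx ky) hd1.
have x0 z : 0 < z -> `|x - x| < z by rewrite subrr normr0.
have T2 := taylor2_near (fun s => u x s) _ _ y _ _ _ _
  (fun s _ => dyP _ _ _ du) (fun s _ => dyP _ _ _ duy)
  (fun s sx => h3 x s (x0 _ d30) sx) kd3.
have T3 := taylor1_near (fun s => dx u x s) _ y _ _ _ _
  (fun s _ => dyP _ _ _ dux) (fun s sx => h2 x s (x0 _ d20) sx) kd2.
have {}T3 := ler_wpM2r (normr_ge0 h) T3.
rewrite -normrM in T3.
have hk : `|k| * `|h| <= h ^+ 2 + k ^+ 2.
  rewrite -[h ^+ 2]real_normK ?num_real// -[k ^+ 2]real_normK ?num_real//.
  have := sqr_ge0 (`|h| - `|k|); have := sqr_ge0 (`|h|); have := sqr_ge0 (`|k|).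
  nra.
have {}hk := ler_wpM2l (ltW e3) hk.
rewrite mulrA in hk.
have T := le_trans (ler_normD _ _) (lerD (le_trans (ler_normD _ _) (lerD T1 T2))
   (le_trans T3 hk)).
have hh := mulr_ge0 (ltW e3) (sqr_ge0 h).
have kk := mulr_ge0 (ltW e3) (sqr_ge0 k).
set lhs := (X in `|X| <= _); set rhs := (X in _ <= X).
match type of T with is_true (`|?l| <= ?r) => have -> : lhs = l end.
  rewrite /lhs /quad.
  move: (u (x + h) (y + k)) (u x (y + k)) (u x y) (dx u x (y + k)) (dx u x y)
    (dy u x y) (dx (dx u) x y) (dy (dx u) x y) (dy (dy u) x y).
  by move=> *; field.
by apply: (le_trans T); rewrite /rhs; lra.
Qed.

Lemma lower_jet_C2 u (x y : R) : C2 u ->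
  lower_jet u x y ((dx (dx u) x y + dy (dy u) x y) / 2).
Proof.
move=> cu; exists (dx u x y), (dy u x y), (dx (dx u) x y / 2), (dy (dx u) x y),
  (dy (dy u) x y / 2); split; first by rewrite mulrDl.
move=> e e0; have [d d0 hd] := C2_taylor u x y e cu e0.
exists d => // h k hh hk; have := hd h k hh hk.
by rewrite ler_norml !lerBrDl addrA => /andP[].
Qed.

(** [lower_jetZ] allows only positive factors, so this uses the other half of the two-sided Taylor
    bound. *)
Lemma lower_jet_C2N u (x y : R) : C2 u ->
  lower_jet (fun a b => - u a b) x y (- ((dx (dx u) x y + dy (dy u) x y) / 2)).
Proof.
move=> cu.
exists (- dx u x y), (- dy u x y), (- (dx (dx u) x y / 2)), (- dy (dx u) x y),
  (- (dy (dy u) x y / 2)); split; first by rewrite mulrDl opprD.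
move=> e e0; have [d d0 hd] := C2_taylor u x y e cu e0.
exists d => // h k hh hk; have := hd h k hh hk.
rewrite ler_norml /quad.
move: (u (x + h) (y + k)) (u x y) (dx u x y) (dy u x y) (dx (dx u) x y)
  (dy (dx u) x y) (dy (dy u) x y) => *; lra.
Qed.

(** The bound [d <= 1] keeps [1 + t] positive. *)
Lemma ln_taylor (e : R) : 0 < e -> exists2 d : R, 0 < d <= 1 & forall t, `|t| < d ->
  `|ln (1 + t) - t + t ^+ 2 / 2| <= e * t ^+ 2.
Proof.
move=> e0.
have cV : (fun s : R => - s ^- 2) @ (1 : R) --> (- 1 : R).
  have := @cvgN _ _ _ _ _ _ _ (@cvgV _ _ _ _ _ _ _ (@exprn_continuous R 2 1)).
  by rewrite !expr1n invr1; apply; exact: oner_neq0.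
have /cvgrPdist_le/(_ _ e0)/nbhs_ballP[d /= d0 hd] := cV.
exists (Num.min d 1); first by rewrite lt_min d0 ltr01 ge_min lexx orbT.
move=> t td.
have spos (s : R) : `|s - 1| < Num.min d 1 -> 0 < s.
  by rewrite lt_min => /andP[_]; rewrite ltr_norml => /andP[]; lra.
have := @taylor2_near (@ln R) (fun s => s^-1) (fun s => - s ^- 2) 1 (-1) e
  (Num.min d 1) t.
rewrite ln1 invr1 !mul1r.
have -> : ln (1 + t) - 0 - t - -1 / 2 * t ^+ 2 = ln (1 + t) - t + t ^+ 2 / 2.
  by field.
apply => //.
- by move=> s /spos; exact: is_derive1_ln.
- move=> s /spos s0; apply: is_derive_eq; first exact: is_deriveV (lt0r_neq0 s0) _.
  by rewrite /GRing.scale /= mulr1.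
- move=> s; rewrite lt_min => /andP[sd _]; rewrite distrC; apply: hd.
  by rewrite /ball /= distrC.
Qed.

(** [C2] is a condition on the whole plane and the logarithm is singular at [(a, b)], so the jet is
    computed by hand: the squared distance becomes [rho + l + n], and [ln (1 + t)] is expanded at
    [t = (l + n) / rho]. *)
Lemma lower_jet_Nln_sqdist (a b x y : R) : 0 < (x - a) ^+ 2 + (y - b) ^+ 2 ->
  lower_jet (fun x y => - ln ((x - a) ^+ 2 + (y - b) ^+ 2)) x y 0.
Proof.
set X := x - a; set Y := y - b; set rho := X ^+ 2 + Y ^+ 2 => rho0.
have rhon0 : rho != 0 by rewrite gt_eqF.
exists (- (2 * X / rho)), (- (2 * Y / rho)), (2 * X ^+ 2 / rho ^+ 2 - rho^-1),
  (4 * X * Y / rho ^+ 2), (2 * Y ^+ 2 / rho ^+ 2 - rho^-1); split.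
  have -> : Y ^+ 2 = rho - X ^+ 2 by rewrite /rho addrAC subrr add0r.
  by field.
move=> e e0.
(* With [t ^+ 2 <= 10 * n / rho] below, the logarithm's remainder is at most [e / 2 * n]; the other
   half of [e] absorbs a cubic term. *)
have er : 0 < e * rho / 20 by rewrite divr_gt0// mulr_gt0.
have [d /andP[d0 d1] hd] := ln_taylor _ er.
set M := `|X| + `|Y| + 1.
have M0 : 0 < M by rewrite ltr_wpDl// addr_ge0.
have n0 n : 0 < n.+1%:R :> R by rewrite ltr0n.
(* In order, the four bounds give [n <= 2 * m], [n <= rho], [|l| <= e * rho ^+ 2 / 2] and
   [|t| < d]. *)
exists (Num.min 1 (Num.min (rho / 2)
  (Num.min (e * rho ^+ 2 / (4 * M)) (d * rho / (4 * M))))).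
  by rewrite !lt_min ltr01 !divr_gt0// ?mulr_gt0// exprn_gt0.
set D := Num.min _ _ => h k hh hk.
set l := 2 * X * h + 2 * Y * k; set n := h ^+ 2 + k ^+ 2.
have hkD : Num.max `|h| `|k| < D by rewrite gt_max hh.
set m := Num.max `|h| `|k| in hkD.
have hm : `|h| <= m by rewrite le_max lexx.
have km : `|k| <= m by rewrite le_max lexx orbT.
have m0 : 0 <= m := le_trans (normr_ge0 h) hm.
move: hkD; rewrite !lt_min => /and4P[m1 mrho].
rewrite !ltr_pdivlMr ?mulr_gt0// in mrho *.
move=> me md.
have l_le : `|l| <= 2 * (`|X| + `|Y|) * m.
  apply: (le_trans (ler_normD _ _)); rewrite !normrM ger0_norm//.
  have := ler_wpM2l (normr_ge0 X) hm; have := ler_wpM2l (normr_ge0 Y) km; lra.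
have n_ge0 : 0 <= n by rewrite addr_ge0 ?sqr_ge0.
have n_le : n <= 2 * m ^+ 2.
  rewrite /n -[h ^+ 2]real_normK ?num_real// -[k ^+ 2]real_normK ?num_real//.
  by rewrite mulr_natl mulr2n lerD// lerXn2r ?nnegrE.
have n_le_m : n <= 2 * m.
  by apply: (le_trans n_le); rewrite ler_pM2l// expr2 ler_piMl// ltW.
have n_rho : n <= rho by apply: (le_trans n_le_m); lra.
have l_e : `|l| <= e * rho ^+ 2 / 2.
  by apply: (le_trans l_le); rewrite /M in me; lra.
have t_d : `|(l + n) / rho| < d.
  rewrite normrM normfV (gtr0_norm rho0) ltr_pdivrMr//.
  apply: le_lt_trans (ler_normD _ _) _; rewrite (ger0_norm n_ge0).
  by rewrite /M in md; have := mulr_ge0 (normr_ge0 X) m0;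
     have := mulr_ge0 (normr_ge0 Y) m0; lra.
(* Cauchy-Schwarz *)
have cs : l ^+ 2 <= 4 * rho * n.
  rewrite -subr_ge0.
  have -> : 4 * rho * n - l ^+ 2 = 4 * (X * k - Y * h) ^+ 2.
    by rewrite /rho /n /l; ring.
  by rewrite mulr_ge0// sqr_ge0.
have nn : n ^+ 2 <= rho * n by rewrite expr2 ler_wpM2r.
(* From [(l + n) ^+ 2 <= 2 * l ^+ 2 + 2 * n ^+ 2] with [cs] and [nn]. *)
have t2 : ((l + n) / rho) ^+ 2 <= 10 * n / rho.
  rewrite expr_div_n ler_pdivrMr ?exprn_gt0//.
  have -> : 10 * n / rho * rho ^+ 2 = 10 * n * rho by field.
  have := sqr_ge0 (l - n); lra.
have lnE : - ln ((x + h - a) ^+ 2 + (y + k - b) ^+ 2) =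
    - ln rho - ln (1 + (l + n) / rho).
  have t1 : 0 < 1 + (l + n) / rho.
    by move: (lt_le_trans t_d d1); rewrite ltr_norml => /andP[]; lra.
  rewrite -opprD -lnM ?posrE//; congr (- ln _).
  rewrite mulrDr mulr1 mulrCA divff// mulr1 /rho /l /n /X /Y; ring.
rewrite lnE.
have := hd _ t_d; rewrite ler_norml => /andP[_ H].
have {}H := le_trans H (ler_wpM2l (ltW er) t2).
have eE : e * rho / 20 * (10 * n / rho) = e / 2 * n by field.
rewrite {}eE in H.
(* The jet is the Taylor polynomial of [- ln (1 + t)] without its terms of order above two in [h],
   [k]. The quartic one has the favourable sign, so only the cubic one needs an estimate. *)
have qE : quad (- (2 * X / rho)) (- (2 * Y / rho))
    (2 * X ^+ 2 / rho ^+ 2 - rho^-1) (4 * X * Y / rho ^+ 2)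
    (2 * Y ^+ 2 / rho ^+ 2 - rho^-1) h k =
  - ((l + n) / rho) + ((l + n) / rho) ^+ 2 / 2
    - (l * n / rho ^+ 2 + (n / rho) ^+ 2 / 2).
  by rewrite /quad /l /n; field.
rewrite qE.
have ln_ge : - (e / 2 * n) <= l * n / rho ^+ 2.
  rewrite ler_pdivlMr ?exprn_gt0//.
  have -> : - (e / 2 * n) * rho ^+ 2 = - (e * rho ^+ 2 / 2) * n by field.
  by rewrite ler_wpM2r//; move: l_e; rewrite ler_norml => /andP[].
have := sqr_ge0 (n / rho).
move: (n / rho) (l * n / rho ^+ 2) ((l + n) / rho) H ln_ge => N L T.
rewrite -/rho -/n.
lra.
Qed.

End Taylor.

(** * Maxima of upper semicontinuous functions on compact sets *)

Lemma usc_compact_max (T : topologicalType) (R : realType) (F : T -> R)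
    (K : set T) : K !=set0 -> compact K ->
  (forall p e, K p -> 0 < e -> \forall q \near p, F q < F p + e) ->
  exists2 p, K p & forall q, K q -> F q <= F p.
Proof.
move=> [k0 Kk0] /compact_near_coveringP cK uF.
have [M KM] : exists M, forall q, K q -> F q < M.
  have /filter_ex[M KM] : \forall M \near +oo, K `<=` [set q | F q < M].
    apply: (cK R +oo (fun M q => F q < M)) => p Kp.
    exists ([set q | F q < F p + 1], [set M | F p + 1 < M]) => /=.
      by split; [exact: uF|apply: nbhs_pinfty_gt; exact: num_real].
    by move=> [q M] /= [qp]; exact: lt_trans qp.
  by exists M.
have sF : has_sup (F @` K).
  split; first by exists (F k0), k0.
  by exists M => _ [q Kq <-]; exact/ltW/KM.
apply: contrapT => noM.
have ltF p : K p -> F p < sup (F @` K).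
  move=> Kp; rewrite ltNge; apply/negP => supp; apply: noM; exists p => // q Kq.
  by apply: le_trans supp; apply: sup_upper_bound => //; exists q.
(* If the supremum is not attained, [F] stays locally below a value less than it; compactness makes
   this uniform and yields a smaller upper bound. *)
have : \forall t \near (sup (F @` K))^'-, K `<=` [set q | F q < t].
  apply: (cK R _ (fun t q => F q < t)) => p Kp.
  exists ([set q | F q < F p + (sup (F @` K) - F p) / 2],
          [set t | F p + (sup (F @` K) - F p) / 2 < t]) => /=.
    split; first by apply: uF => //; rewrite divr_gt0// subr_gt0 ltF.
    by apply: nbhs_left_gt; have := ltF p Kp; lra.
  by move=> [q t] /= [qp]; exact: lt_trans qp.
move=> /(filterI (nbhs_left_lt _)) /filter_ex[t [/= ts Kt]].
move: ts; rewrite ltNge => /negP; apply.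
by apply: ge_sup => [|_ [q Kq <-]]; [exists (F k0), k0 | exact/ltW/Kt].
Qed.

(** * The Phragmen-Lindelof principle and Liouville's theorem *)

Section Liouville.
Variable R : realType.
Implicit Types (u v w : R -> R -> R) (Phi : R -> R).

Let sqd (a b : R) (p : R * R) : R := (p.1 - a) ^+ 2 + (p.2 - b) ^+ 2.

Let sqd_cont a b : continuous (sqd a b).
Proof.
move=> p; have -> : sqd a b = fun q => (q.1 - a) * (q.1 - a) + (q.2 - b) * (q.2 - b).
  by apply/funext => q; rewrite /sqd !expr2.
by apply: cvgD; apply: cvgM; apply: cvgB;
  (exact: cvg_cst || exact: cvg_fst || exact: cvg_snd).
Qed.

Let compact_sqd_le (a b r : R) : compact [set p | sqd a b p <= r].
Proof.
(* [z ^+ 2 <= r] forces [|z| <= |r| + 1], which avoids a square root. *)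
pose s := `|r| + 1.
apply: (@subclosed_compact _ _ (`[a - s, a + s] `*` `[b - s, b + s])).
- by apply: preimage_closed (@closed_le R r) => p _; exact: sqd_cont.
- by apply: compact_setX; exact: segment_compact.
- move=> [x y]; rewrite /sqd /= => xy; rewrite !in_itv /=.
  have H (z : R) : z ^+ 2 <= r -> `|z| <= s.
    have := ler_norm r; have := normr_ge0 r.
    rewrite /s -[z ^+ 2]real_normK ?num_real//; have := normr_ge0 z; nra.
  have /H : (x - a) ^+ 2 <= r by have := sqr_ge0 (y - b); lra.
  have /H : (y - b) ^+ 2 <= r by have := sqr_ge0 (x - a); lra.
  by rewrite !ler_norml => /andP[? ?] /andP[? ?]; split; apply/andP; split; lra.
Qed.

Lemma usc_addl w (g : R * R -> R) (p : R * R) (e : R) : usc w ->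
  {for p, continuous g} -> 0 < e ->
  \forall q \near p, w q.1 q.2 + g q < w p.1 p.2 + g p + e.
Proof.
move=> uw cg e0; have e2 : 0 < e / 2 by rewrite divr_gt0.
have := uw p _ e2; have /cvgrPdist_lt/(_ _ e2) := cg.
apply: filterS2 => q; rewrite ltr_norml => /andP[? ?]; lra.
Qed.

(** If [w + v] exceeds [m] by [s] at [q], add [- eta * ln (sqd / d) + kap * sqd], up to a constant.
    The logarithm keeps the maximum off a large circle, the excess over [m] keeps it off the
    boundary of [Z], and [kap] makes the jet positive, which excludes an interior maximum. *)
Lemma phragmen_lindelof w v (Z : set (R * R)) (a b d C m : R) :
  subharmonic_fun w -> jcont v -> (forall x y, lower_jet v x y 0) ->
  closed Z -> 0 < d ->
  (forall p, Z p -> d <= (p.1 - a) ^+ 2 + (p.2 - b) ^+ 2) ->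
  (forall p, Z p -> w p.1 p.2 + v p.1 p.2 <= C) ->
  (forall p, Z p -> ~ nbhs p Z -> w p.1 p.2 + v p.1 p.2 <= m) ->
  forall p, Z p -> w p.1 p.2 + v p.1 p.2 <= m.
Proof.
move=> sw cv jv cZ d0 Zd ZC Zm q Zq.
rewrite leNgt; apply/negP => mq.
pose s := w q.1 q.2 + v q.1 q.2 - m.
have s0 : 0 < s by rewrite subr_gt0.
have Zd' p : Z p -> d <= sqd a b p := Zd p.
have Zpos p : Z p -> 0 < sqd a b p by move=> /Zd'; exact: lt_le_trans.
have lnZ p : Z p -> ln d <= ln (sqd a b p).
  by move=> Zp; rewrite ler_ln ?posrE ?Zpos// Zd'.
pose l := ln (sqd a b q) - ln d.
have l0 : 0 <= l by rewrite subr_ge0 lnZ.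
(* The logarithmic term costs at most [s / 4] at [q]. *)
pose eta := s / (4 * (l + 1)).
have eta0 : 0 < eta by rewrite divr_gt0// mulr_gt0// ltr_wpDl.
have etal : eta * l <= s / 4.
  rewrite /eta mulrAC ler_pdivrMr ?mulr_gt0 ?ltr_wpDl//; nra.
(* [X] will be [ln (r / d)]: [eta * X > C - m] serves on the circle [sqd = r], and [X >= l] puts [q]
   in [K]. *)
pose X := l + 1 + `|C - m| / eta.
have CX : C - m < eta * X.
  have -> : eta * X = eta * l + eta + `|C - m|.
    by rewrite /X; field; rewrite gt_eqF.
  by have := ler_norm (C - m); have := mulr_ge0 (ltW eta0) l0; lra.
have lX : l <= X.
  by rewrite /X -addrA lerDl addr_ge0// divr_ge0// ltW.
pose r := d * expR X.
have r0 : 0 < r by rewrite mulr_gt0// expR_gt0.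
have lnr : ln r = ln d + X by rewrite lnM ?posrE ?expR_gt0// expRK.
pose kap := s / (4 * r).
have kap0 : 0 < kap by rewrite divr_gt0// mulr_gt0.
have kapr : kap * r = s / 4 by rewrite /kap; field; rewrite gt_eqF.
pose K := Z `&` [set p | sqd a b p <= r].
have Kq : K q.
  split => //=; rewrite -ler_ln ?posrE ?Zpos// lnr; move: lX; rewrite /l; lra.
have cK : compact K.
  apply: subclosed_compact (compact_sqd_le a b r) _; last by move=> p [].
  apply: closedI => //.
  by apply: preimage_closed (@closed_le R r) => p _; exact: sqd_cont.
pose g x y := v x y + (eta * - ln ((x - a) ^+ 2 + (y - b) ^+ 2)
  + kap * ((x - a) ^+ 2 + (y - b) ^+ 2)).
have gE p : g p.1 p.2 = v p.1 p.2 + (eta * - ln (sqd a b p) + kap * sqd a b p).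
  by [].
have cg p : Z p -> {for p, continuous (fun p : R * R => g p.1 p.2)}.
  move=> Zp; apply: cvgD; first exact: cv.
  apply: cvgD; apply: cvgM; try exact: cvg_cst; last exact: sqd_cont.
  by apply: cvgN; exact: continuous_comp (@sqd_cont a b p) (continuous_ln (Zpos p Zp)).
have [|p [Zp /= pr] pmax] := @usc_compact_max _ R
    (fun p : R * R => w p.1 p.2 + g p.1 p.2) K (ex_intro _ q Kq) cK.
  by move=> p e [Zp _]; apply: usc_addl (cg p Zp); exact: sw.1.
have qp := pmax q Kq; rewrite !gE in qp.
have kq : 0 <= kap * sqd a b q by rewrite mulr_ge0 ?ltW ?Zpos.
have kp : kap * sqd a b p <= s / 4 by rewrite -kapr ler_pM2l.
have lp : 0 <= eta * (ln (sqd a b p) - ln d).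
  by rewrite mulr_ge0 ?(ltW eta0)// subr_ge0 lnZ.
(* Comparing [p] with [q] loses [s / 4] to the logarithm at [q] and [s / 4] to the [kap] term at
   [p]. *)
have hp : m + s / 2 + eta * (ln (sqd a b p) - ln d) <= w p.1 p.2 + v p.1 p.2.
  by move: etal; rewrite /l; have : s = w q.1 q.2 + v q.1 q.2 - m by []; lra.
have nZ : nbhs p Z.
  by apply: contrapT => /(Zm p Zp); lra.
have lt_r : sqd a b p < r.
  rewrite -ltr_ln ?posrE ?Zpos// lnr -ltrBlDl -(ltr_pM2l eta0).
  by have := ZC p Zp; lra.
have jg : lower_jet g p.1 p.2 (0 + (eta * 0 + kap * 2)).
  apply: lower_jetD; first exact: jv.
  apply: lower_jetD; apply: lower_jetZ => //; last exact: lower_jet_sqdist.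
  by apply: lower_jet_Nln_sqdist; exact: Zpos.
apply: (subharmonic_add_jet_no_max _ _ _ _ _ _ sw jg).
  by rewrite mulr0 !add0r mulr_gt0.
have nr : \forall p' \near p, sqd a b p' < r.
  exact: (@sqd_cont a b p [set z | z < r] (lt_nbhsl lt_r)).
rewrite -surjective_pairing; apply: filterS2 nZ nr => p' Zp' rp'.
by apply: pmax; split => //=; exact: ltW.
Qed.

(** Semicontinuity bounds [w + v] on a small disc about [(x', y')] by its value there plus [e];
    outside the disc this is the boundary bound of [phragmen_lindelof]. *)
Lemma liouville w v (C : R) :
  subharmonic_fun w -> jcont v -> (forall x y, lower_jet v x y 0) ->
  (forall x y, w x y + v x y <= C) ->
  forall x y x' y', w x y + v x y <= w x' y' + v x' y'.
Proof.
move=> sw cv jv wC x y x' y'; apply/ler_addgt0Pr => e e0.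
have /nbhs_ballP[d /= d0 hd] := usc_addl w _ (x', y') e sw.1 (cv (x', y')) e0.
(* The product ball of radius [d] is a square; it contains the disc of squared radius [r]. *)
pose r := (d / 2) ^+ 2.
have r0 : 0 < r by rewrite exprn_gt0// divr_gt0.
have in_ball p : sqd x' y' p <= r -> w p.1 p.2 + v p.1 p.2 <= w x' y' + v x' y' + e.
  move=> pr; apply/ltW/hd; move: pr; rewrite /sqd => pr.
  have H (z : R) : z ^+ 2 <= r -> `|z| < d.
    rewrite /r -[z ^+ 2]real_normK ?num_real//.
    rewrite ler_pXn2r ?nnegrE ?divr_ge0 ?(ltW d0)// => /le_lt_trans; apply.
    by rewrite ltr_pdivrMr// ltr_pMr// ltr1n.
  by split; rewrite /ball /= distrC; apply: H; apply: le_trans pr;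
    [rewrite lerDl|rewrite lerDr]; exact: sqr_ge0.
have [lr|lr] := leP (sqd x' y' (x, y)) r; first exact: (in_ball (x, y)).
apply: (phragmen_lindelof w v [set p | r <= sqd x' y' p] x' y' r C _ sw cv jv
  _ r0 _ _ _ (x, y)) => //=.
- by apply: preimage_closed (@closed_ge R r) => p _; exact: sqd_cont.
- move=> p _ np; apply: in_ball; rewrite leNgt; apply/negP => rp; apply: np.
  have : \forall p' \near p, r < sqd x' y' p'.
    exact: (@sqd_cont x' y' p [set z | r < z] (lt_nbhsr rp)).
  by apply: filterS => p' /ltW.
- exact: ltW.
Qed.

(** * Sublinear growth of [Phi], and its consequences by the sign of [u] *)

Lemma sublinear_bound Phi (eps : R) : locally_bounded Phi ->
  (Phi t / `|t|) @[t --> +oo] --> 0 -> 0 < eps ->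
  exists C, forall t, 0 <= t -> Phi t <= eps * t + C.
Proof.
move=> lb /cvgrPdist_le/(_ _ (_ : 0 < eps)) + eps0 => /(_ eps0) [T [_ PhiT]].
pose S := Num.max T 0 + 1.
have ST : T < S by rewrite ltr_pwDr// le_max lexx.
have S0 : 0 < S by rewrite ltr_pwDr// le_max lexx orbT.
(* Compactness turns local boundedness into one bound on [[0, S]]; beyond [S] the limit gives
   [Phi t <= eps * t]. *)
have /filter_ex[M PhiM] : \forall M \near +oo, `[0, S] `<=` [set t | Phi t <= M].
  have /compact_near_coveringP cS := @segment_compact R 0 S.
  apply: (cS R +oo (fun M t => Phi t <= M)) => t _.
  have [M Mt] := lb t.
  exists ([set s | `|Phi s| <= M], [set N | M < N]) => /=.
    by split; [exact: Mt|apply: nbhs_pinfty_gt; exact: num_real].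
  move=> [s N] /= [sM MN]; apply/ltW; apply: le_lt_trans MN.
  exact: le_trans (ler_norm _) sM.
exists `|M| => t t0; have [tS|St] := leP t S.
  apply: (@le_trans _ _ M); first by apply: PhiM; rewrite /= in_itv /= t0.
  by apply: (le_trans (ler_norm M)); rewrite lerDr mulr_ge0 ?(ltW eps0).
have tpos : 0 < t := lt_trans S0 St.
have := PhiT t (lt_trans ST St); rewrite sub0r normrN normrM normfV normr_id.
rewrite (gtr0_norm tpos) ler_pdivrMr// => H.
by apply: (le_trans (le_trans (ler_norm _) H)); rewrite lerDl.
Qed.

(** [w - eps * u] is bounded by a constant [C] that depends on [eps] but does not enter Liouville's
    conclusion. The choice of [eps] makes [eps * u x y <= e]. *)
Lemma const_of_nonneg w u Phi : subharmonic_fun w ->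
  jcont u -> (forall x y, lower_jet (fun a b => - u a b) x y 0) ->
  (forall eps, 0 < eps -> exists C, forall t, 0 <= t -> Phi t <= eps * t + C) ->
  (forall x y, w x y <= Phi (u x y)) -> (forall x y, 0 <= u x y) ->
  forall x y x' y', w x y <= w x' y'.
Proof.
move=> sw cu ju bPhi wPhi u0 x y x' y'.
apply/ler_addgt0Pr => e e0.
pose eps := e / (1 + u x y).
have uxy : 0 < 1 + u x y by rewrite ltr_pwDl.
have eps0 : 0 < eps by rewrite divr_gt0.
have [C PhiC] := bPhi eps eps0.
have := liouville w (fun a b => eps * - u a b) C sw.
have -> : w x y <= w x' y' + e =
    (w x y + eps * - u x y <= w x' y' + e - eps * u x y).
  by rewrite mulrN lerD2r.
move=> H; apply: le_trans (H _ _ _ x y x' y') _.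
- by move=> p; apply: cvgM; [exact: cvg_cst|apply: cvgN; exact: cu].
- by move=> a b; rewrite -(mulr0 eps); exact: lower_jetZ.
- by move=> a b; have := wPhi a b; have := PhiC _ (u0 a b); lra.
- have : eps * (1 + u x y) = e by rewrite /eps divfK// gt_eqF.
  have := mulr_ge0 (ltW eps0) (u0 x' y'); lra.
Qed.

Lemma bound_of_pos w u Phi : subharmonic_fun w ->
  jcont u -> (forall x y, lower_jet (fun a b => - u a b) x y 0) ->
  (forall eps, 0 < eps -> exists C, forall t, 0 <= t -> Phi t <= eps * t + C) ->
  (forall x y, w x y <= Phi (u x y)) -> (exists a b, u a b < 0) ->
  forall x y, 0 <= u x y -> w x y <= Phi 0.
Proof.
move=> sw cu ju bPhi wPhi [a [b uab]] x y u0.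
have : \forall q \near (a, b), u q.1 q.2 < 0.
  exact: (cu (a, b) [set z | z < 0] (lt_nbhsl uab)).
move=> /nbhs_ballP[d /= d0 hd].
apply/ler_addgt0Pr => e e0.
pose eps := e / (1 + u x y).
have uxy : 0 < 1 + u x y by rewrite ltr_pwDl.
have eps0 : 0 < eps by rewrite divr_gt0.
have [C PhiC] := bPhi eps eps0.
have epsu : eps * u x y <= e.
  have : eps * (1 + u x y) = e by rewrite /eps divfK// gt_eqF.
  lra.
suff : w x y + eps * - u x y <= Phi 0 by lra.
(* The disc where [u < 0] keeps the set away from [(a, b)]; its radius enters squared, like the
   distance. *)
apply: (phragmen_lindelof w (fun a b => eps * - u a b)
  [set p | 0 <= u p.1 p.2] a b (d ^+ 2) C (Phi 0) sw _ _ _ _ _ _ _ (x, y)) => //=.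
- by move=> p; apply: cvgM; [exact: cvg_cst|apply: cvgN; exact: cu].
- by move=> s t; rewrite -(mulr0 eps); exact: lower_jetZ.
- by apply: preimage_closed (@closed_ge R 0) => p _; exact: cu.
- by rewrite exprn_gt0.
- move=> p up; rewrite leNgt; apply/negP => pd; move: up.
  rewrite leNgt => /negP; apply; apply: (hd p).
  have H (z : R) : z ^+ 2 < d ^+ 2 -> `|z| < d.
    by rewrite -[z ^+ 2]real_normK ?num_real// ltr_pXn2r ?nnegrE ?(ltW d0).
  by split; rewrite /ball /= distrC; apply: H; apply: le_lt_trans pd;
    [rewrite lerDl|rewrite lerDr]; exact: sqr_ge0.
- by move=> p up; have := wPhi p.1 p.2; have := PhiC _ up; lra.
- move=> p up nZ.
  (* If [u] were positive at [p], continuity would make [p] interior; so [u] vanishes at boundary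
     points. *)
  have -> : Phi 0 = Phi (u p.1 p.2).
    congr Phi; apply/eqP; rewrite eq_le up leNgt; apply/negP => up0; apply: nZ.
    have : \forall q \near p, 0 < u q.1 q.2.
      exact: (cu p [set z | 0 < z] (lt_nbhsr up0)).
    by apply: filterS => q /ltW.
  have := mulr_ge0 (ltW eps0) up; have := wPhi p.1 p.2; lra.
Qed.

End Liouville.

(** * Conclusion by cases on the sign of [u] *)

Theorem theorem4 (R : realType) (w u : R -> R -> R) (Phi : R -> R) :
  subharmonic_fun w -> harmonic_fun u ->
  (forall t, 0 <= Phi t) -> locally_bounded Phi ->
  (Phi t / `|t|) @[t --> +oo] --> 0 ->
  (Phi t / `|t|) @[t --> -oo] --> 0 ->
  (forall x y, w x y <= Phi (u x y)) ->
  exists c : R, forall x y, w x y = c.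
Proof.
move=> sw [cu lapu] _ lb Phiy PhiNy wPhi.
suff wle x y x' y' : w x y <= w x' y'.
  by exists (w 0 0) => x y; apply/eqP; rewrite eq_le !wle.
have ju a b : lower_jet u a b 0.
  by rewrite -(mul0r 2^-1) -(lapu a b); exact: lower_jet_C2.
have jNu a b : lower_jet (fun a b => - u a b) a b 0.
  by rewrite -oppr0 -(mul0r 2^-1) -(lapu a b); exact: lower_jet_C2N.
have jNNu a b : lower_jet (fun a b => - - u a b) a b 0.
  by have -> : (fun a b => - - u a b) = u by do 2 apply/funext => ?; rewrite opprK.
have jcu : jcont u by case: cu => _ [_ [_ []]].
have jcNu : jcont (fun a b => - u a b) by move=> p; apply: cvgN; exact: jcu.
have bPhi eps : 0 < eps -> exists C, forall t, 0 <= t -> Phi t <= eps * t + C.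
  exact: sublinear_bound.
(* Replacing [u] by [- u] and [Phi] by its reflection reduces nonpositive values of [u] to
   nonnegative ones. *)
have bPhiN eps : 0 < eps ->
    exists C, forall t, 0 <= t -> Phi (- t) <= eps * t + C.
  apply: (sublinear_bound _ (fun t => Phi (- t))).
    move=> t; have [M hM] := lb (- t); exists M.
    exact: ((cvgN cvg_id : - s @[s --> t] --> - t) _ hM).
  move/cvgNy_compNP: PhiNy; apply: cvg_trans; apply: near_eq_cvg.
  by apply: nearW => t /=; rewrite normrN.
have wPhiN x0 y0 : w x0 y0 <= Phi (- - u x0 y0) by rewrite opprK.
have [uneg|/forallNP uneg] := pselect (exists a b, u a b < 0); last first.
  apply: (const_of_nonneg _ w u Phi) => // a b.
  by rewrite leNgt; apply/negP => uab; apply: (uneg a); exists b.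
have [upos|/forallNP upos] := pselect (exists a b, - u a b < 0); last first.
  apply: (const_of_nonneg _ w (fun a b => - u a b) (fun t => Phi (- t))) => // a b.
  by rewrite leNgt; apply/negP => uab; apply: (upos a); exists b.
have wP0 a b : w a b <= Phi 0.
  have [u0|u0] := leP 0 (u a b).
    exact: (bound_of_pos _ w u Phi).
  rewrite -[0]oppr0; apply: (bound_of_pos _ w (fun a b => - u a b)
    (fun t => Phi (- t))) => //; by rewrite oppr_ge0 ltW.
have := liouville _ w (fun _ _ => 0) (Phi 0) sw.
(* The zero function gets its jet as the sum of those of [u] and [- u]. *)
have H : lower_jet (fun _ _ => 0) = lower_jet (fun a b => u a b + - u a b).
  by congr lower_jet; apply/funext => a; apply/funext => b; rewrite subrr.
move=> /(_ _ _ _ x y x' y'); rewrite !addr0; apply.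
- by move=> p; exact: cvg_cst.
- by move=> a b; rewrite H -[0]addr0; exact: lower_jetD.
- by move=> a b; rewrite addr0.
Qed.
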